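(* Let $p$ be a prime number. If $f: \mathbb{Z}/p\mathbb{Z} \to \mathbb{C}$ is a non-zero function, then $$|\operatorname{supp}(f)| + |\operatorname{supp}(\hat f)| \geq p+1.$$ Conversely, if $A$ and $B$ are two non-empty subsets of $\mathbb{Z}/p\mathbb{Z}$ such that $|A| + |B| \geq p+1$, then there exists a function $f: \mathbb{Z}/p\mathbb{Z} \to \mathbb{C}$ such that $\operatorname{supp}(f) = A$ and $\operatorname{supp}(\hat f) = B$.
   Context: For a function $f: \mathbb{Z}/p\mathbb{Z} \to \mathbb{C}$, the Fourier transform $\hat f: \mathbb{Z}/p\mathbb{Z} \to \mathbb{C}$ is defined by $$\hat f(\xi) := \frac{1}{p} \sum_{x \in \mathbb{Z}/p\mathbb{Z}} f(x)\, e^{-2\pi i x\xi/p}.$$ The support of a function $f: \mathbb{Z}/p\mathbb{Z} \to \mathbb{C}$ is $\operatorname{supp}(f) := \{x \in \mathbb{Z}/p\mathbb{Z} : f(x) \neq 0\}$. $|X|$ denotes the cardinality of a finite set $X$. *)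

(* Defs.v *)
From mathcomp Require Import all_boot all_order all_algebra.
From mathcomp Require Import complex.
From mathcomp Require Import reals sequences exp trigo.

Set Implicit Arguments.
Unset Strict Implicit.
Unset Printing Implicit Defensive.

Import Order.TTheory GRing.Theory Num.Theory.

Local Open Scope ring_scope.
Local Open Scope complex_scope.

Definition cexp (R : realType) (z : R[i]) : R[i] :=
  (expR (complex.Re z))%:C
  * (cos (complex.Im z) +i* sin (complex.Im z)).

Definition supp (R : realType) (T : finType) (f : {ffun T -> R[i]}) : {set T} :=
  [set x | f x != 0].

(* The elements x and xi enter the exponential through their representatives
   in {0, ..., p - 1}, which is harmless since the exponential is p-periodic
   in each of them. The type 'Z_p is Z/pZ only for 1 < p; it does not determine
   p up to conversion, hence the explicit argument. *)
Definition fourier (R : realType) (p : nat) (f : {ffun 'Z_p -> R[i]}) :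
    {ffun 'Z_p -> R[i]} :=
  [ffun xi : 'Z_p => p%:R^-1 *
    \sum_(x : 'Z_p)
      f x * cexp (- (2 * (pi : R)%:C * 'i%C * (x : nat)%:R * (xi : nat)%:R) / p%:R)].

Arguments fourier {R} p f.

(* Main.v *)
(** The first half rests on Chebotarev's theorem that all minors of the Fourier
    matrix (w^(xy)) of prime order are non-zero. Over Z[X], dividing the Y^(y_j)
    by the product of the Y - X^(x_i) factors (X^(x_i y_j)) as a Vandermonde
    matrix times the matrix S of the coefficients of the remainders. If det S
    vanished at X = w, it would vanish at X = 1 modulo p, and a non-zero
    polynomial over F_p of degree < p with n terms would be divisible by
    (Y - 1)^n (Frenkel); applying Y d/dY repeatedly shows this is impossible.

    For the converse with |A| + |B| = p + 1, counting dimensions gives f <> 0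
    supported in A with transform supported in B, and the first half forces
    equality. In general, a generic linear combination of such functions works. *)
Require Import Defs.
From mathcomp Require Import all_boot all_order all_algebra.
From mathcomp Require Import complex.
From mathcomp Require Import reals sequences exp trigo.
From mathcomp Require Import ring.

Set Implicit Arguments.
Unset Strict Implicit.
Unset Printing Implicit Defensive.

Import Order.TTheory GRing.Theory Num.Theory.

Local Open Scope ring_scope.
Local Open Scope complex_scope.

(** * Roots of unity and Chebotarev's theorem on minors *)

(* The primitive gcd of P and X^p - 1 in Z[X] is non-constant, and modulo p it
   divides X^p - 1 = (X - 1)^p, hence vanishes at 1. *)
Lemma int_poly_unity_root (K : numFieldType) (p : nat) (w : K) (P : {poly int}) :
  prime p -> w ^+ p = 1 -> (map_poly intr P).[w] = 0 ->
  (P.[1])%:~R = 0 :> 'F_p.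
Proof.
move=> p_pr wp1 Pw0; pose Q : {poly int} := 'X^p - 1; pose g := gcdp P Q.
have Qw0 : (map_poly intr Q).[w] = 0 :> K.
  by rewrite rmorphB rmorph1 /= map_polyXn !hornerE wp1 subrr.
have Q_monic : Q \is monic by rewrite /Q -polyC1 monicXnsubC ?prime_gt0.
(* Otherwise a Bezout relation u P + v Q = d <> 0, evaluated at w, would give d = 0. *)
have g_gt1 : (1 < size g)%N.
  rewrite ltn_neqAle eq_sym lt0n size_poly_eq0 gcdp_eq0 (negPf (monic_neq0 Q_monic)).
  rewrite andbF andbT; apply/negP => /Bezout_coprimepP[u /eqpP[[c d] /=]].
  case/andP=> _ d_neq0 /(congr1 (fun r => (map_poly (intr : int -> K) r).[w])).
  rewrite -!mul_polyC !rmorphM rmorphD !rmorphM rmorph1 /= !map_polyC /=.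
  rewrite !hornerE Pw0 Qw0 !mulr0 addr0 mulr0 => /esym/eqP.
  by rewrite intr_eq0 (negPf d_neq0).
have [r1 defP] := dvdpP_int (dvdp_gcdl P Q : g %| P).
have [r2 defQ] := dvdpP_int (dvdp_gcdr P Q : g %| Q).
pose phi := map_poly (intr : int -> 'F_p); pose z := zprimitive g.
(* A leading coefficient dividing 1 survives reduction modulo [p], so [phi z] keeps the degree of
   [z]. *)
have lead_z : lead_coef z * lead_coef r2 = 1.
  by rewrite -lead_coefM -defQ (monicP Q_monic).
have size_phi_z : (1 < size (phi z))%N.
  rewrite size_map_poly_id0 ?size_zprimitive //.
  apply/negP => /eqP z0; have := congr1 (intr : int -> 'F_p) lead_z.
  by rewrite rmorphM /= z0 mul0r => /eqP; rewrite eq_sym oner_eq0.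
have phi_z_dvd : phi z %| ('X - 1) ^+ p.
  have pcharX : p \in [pchar {poly 'F_p}] by rewrite pchar_poly pchar_Fp.
  have -> : ('X - 1) ^+ p = phi Q.
    rewrite /phi /Q [RHS]rmorphB /= map_polyXn -(pFrobenius_autE pcharX).
    rewrite (pFrobenius_autB_comm _ (commr1 'X)) pFrobenius_aut1.
    by rewrite pFrobenius_autE [X in _ = _ - X]rmorph1.
  by rewrite /phi defQ rmorphM dvdp_mulr.
have z1 : root (phi z) 1.
  rewrite -[root _ _]negbK -coprimep_XsubC polyC1; apply/negP => /coprimep_expr.
  move=> /(_ p) cop; move: size_phi_z.
  by have := coprimepp (phi z); rewrite (coprimep_dvdl phi_z_dvd cop) => /esym/eqP ->.
transitivity ((phi P).[1]); first by rewrite -[in RHS](rmorph1 intr) horner_map.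
by rewrite /phi defP rmorphM hornerM (rootP z1) mul0r.
Qed.

(** By the product rule, each application of X d/dX costs at most one factor X - 1. *)
Lemma dvdp_iter_XderivM (F : fieldType) (n k : nat) (g : {poly F}) :
  (k <= n)%N -> ('X - 1%:P) ^+ n %| g ->
  ('X - 1%:P) ^+ (n - k) %| iter k (fun h => 'X * h^`()) g.
Proof.
move=> + dvd_g; elim: k => [|k IHk] lt_k_n; first by rewrite subn0.
have /dvdpP[q] := IHk (ltnW lt_k_n); rewrite iterS => ->.
rewrite -[(n - k)%N]prednK ?subn_gt0 // -subnS.
set m := (n - k.+1)%N; rewrite derivM deriv_exp derivXsubC mul1r /=.
apply/dvdp_mull/dvdp_add; first by rewrite exprS mulrA dvdp_mull.
by rewrite dvdp_mull // -mulr_natl dvdp_mull.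
Qed.

(** For k < n, applying X d/dX k times multiplies [a j] by (y j)^k and keeps the root 1. Evaluation
    at 1 then gives a Vandermonde system in the [a j] with distinct nodes [y j]. *)
Lemma sparse_poly_unity_mult (F : fieldType) (n : nat) (y : 'I_n -> nat)
    (a : 'I_n -> F) :
  injective (fun j => (y j)%:R : F) ->
  ('X - 1%:P) ^+ n %| \sum_j a j *: 'X^(y j) -> forall j, a j = 0.
Proof.
move=> y_inj dvd_n.
pose theta (h : {poly F}) := 'X * h^`().
have theta_sum k : iter k theta (\sum_j a j *: 'X^(y j)) =
    \sum_j (a j * (y j)%:R ^+ k) *: 'X^(y j).
  elim: k => [|k IHk]; first by apply: eq_bigr => j _; rewrite mulr1.
  rewrite iterS IHk /theta raddf_sum mulr_sumr; apply: eq_bigr => j _ /=.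
  rewrite derivZ derivXn -scalerAr mulrnAr -scaler_nat scalerA.
  (* At exponent 0 the truncated predecessor breaks X * X^(m-1) = X^m, but there the coefficient is
     zero. *)
  rewrite -mulrA -exprSr; case: (y j) => [|m]; last by rewrite -exprS.
  by rewrite expr0n mulr0 !scale0r.
pose b := \row_j (y j)%:R : 'rV[F]_n.
have V_unit : Vandermonde n b \in unitmx.
  rewrite unitmxE unitfE det_Vandermonde.
  apply/prodf_neq0 => i _; apply/prodf_neq0 => j lt_ij.
  by rewrite !mxE subr_eq0 (inj_eq y_inj) gt_eqF.
suff: Vandermonde n b *m (\col_j a j) = 0.
  move/(congr1 (mulmx (invmx (Vandermonde n b)))).
  by rewrite mulKmx // mulmx0 => /matrixP aE j; have := aE j 0; rewrite !mxE.
apply/matrixP => k l; rewrite !mxE.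
have := dvdp_iter_XderivM (ltnW (ltn_ord k)) dvd_n.
rewrite -/theta theta_sum -(subnSK (ltn_ord k)) exprS => /dvdpP[q].
move/(congr1 (fun r => r.[1])); rewrite !hornerM hornerXsubC subrr mul0r mulr0 => q0.
rewrite -[RHS]q0 horner_sum; apply: eq_bigr => j _.
by rewrite !mxE hornerZ hornerXn expr1n mulr1 mulrC.
Qed.

(** At X = 1 all nodes X^(x i) coincide and the minor degenerates; once the Vandermonde factor is
    split off, [det S] can still be tested there. *)
Lemma chebotarev_minor (K : numFieldType) (p : nat) (w : K) (n : nat)
    (x y : 'I_n -> nat) :
  prime p -> p.-primitive_root w ->
  injective x -> (forall i, x i < p)%N -> injective y -> (forall j, y j < p)%N ->
  \det (\matrix_(i < n, j < n) w ^+ (x i * y j)) != 0.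
Proof.
move=> p_pr w_prim x_inj x_lt y_inj y_lt.
pose Z : 'rV[{poly int}]_n := \row_i 'X^(x i).
pose W : {poly {poly int}} := \prod_i ('X - (Z 0 i)%:P).
have W_monic : W \is monic by apply: monic_prod_XsubC.
have sizeW : size W = n.+1.
  by rewrite /W size_prod_XsubC /index_enum -enumT size_enum_ord.
(* Division with remainder works over the ring [{poly int}] because [W] is monic. *)
pose q (j : 'I_n) := Pdiv.CommonRing.rdivp 'X^(y j) W.
pose r (j : 'I_n) := Pdiv.CommonRing.rmodp 'X^(y j) W.
have qrE j : 'X^(y j) = q j * W + r j by apply: Pdiv.RingMonic.rdivp_eq.
have size_r j : (size (r j) <= n)%N.
  by rewrite -ltnS -sizeW Pdiv.CommonRing.ltn_rmodp monic_neq0.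
pose S := \matrix_(k < n, j < n) (r j)`_k.
have MVS : \matrix_(i < n, j < n) 'X^(x i * y j) = (Vandermonde n Z)^T *m S.
  apply/matrixP => i j; rewrite !mxE.
  (* The nodes are roots of [W], so [r j] and Y^(y j) agree there. *)
  have W0 : W.[Z 0 i] = 0.
    by rewrite /W horner_prod (bigD1 i) //= hornerXsubC subrr mul0r.
  have := congr1 (horner^~ (Z 0 i)) (qrE j).
  rewrite /= hornerD hornerM W0 mulr0 add0r hornerXn !mxE -exprM => ->.
  rewrite (horner_coef_wide _ (size_r j)); apply: eq_bigr => k _.
  by rewrite !mxE mulrC.
pose ev := horner_eval w \o map_poly (intr : int -> K).
have evE P : ev P = (map_poly intr P).[w] by [].
have -> : \matrix_(i < n, j < n) w ^+ (x i * y j) =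
    map_mx ev (\matrix_(i < n, j < n) 'X^(x i * y j)).
  by apply/matrixP => i j; rewrite !mxE evE map_polyXn hornerXn.
rewrite MVS det_map_mx det_mulmx rmorphM mulf_neq0 //.
  rewrite det_tr det_Vandermonde rmorph_prod; apply/prodf_neq0 => i _.
  rewrite rmorph_prod; apply/prodf_neq0 => j lt_ij.
  rewrite !mxE rmorphB /= /horner_eval !map_polyXn !hornerXn subr_eq0.
  rewrite (eq_prim_root_expr w_prim) !modn_small //.
  by apply: contraTneq lt_ij => /x_inj ->; rewrite ltnn.
apply/negP => /eqP /= detS0.
have := int_poly_unity_root p_pr (prim_expr_order w_prim) detS0.
have redE P : (P.[1])%:~R = (intr \o horner_eval 1) P :> 'F_p by [].
(* The entries of [v] are the coefficients of a linear relation between the remainders [r j], taken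
   at X = 1 modulo [p]. *)
rewrite redE -det_map_mx -det_tr => /eqP/det0P[v v_neq0 /matrixP vS0].
case/negP: v_neq0; apply/eqP/rowP => j; rewrite mxE; move: j.
apply: (@sparse_poly_unity_mult _ _ y).
  (* Exponents below [p] remain distinct in ['F_p]. *)
  move=> i j /(congr1 (fun a : 'F_p => a : nat)).
  by rewrite !val_Fp_nat // !modn_small // => /y_inj.
pose phi := map_poly (intr \o horner_eval (1 : int) : {poly int} -> 'F_p).
have phiW : phi W = ('X - 1%:P) ^+ n.
  rewrite /phi /W map_prod_XsubC (eq_bigr (fun=> 'X - 1%:P)).
    by rewrite prodr_const card_ord.
  by move=> i _; rewrite !mxE /= /horner_eval hornerXn expr1n.
have -> : \sum_j v 0 j *: 'X^(y j) = (\sum_j v 0 j *: phi (q j)) * phi W.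
  have phi_r : \sum_j v 0 j *: phi (r j) = 0.
    apply/polyP => k; rewrite coef_sum coef0.
    have [lt_kn|le_nk] := ltnP k n.
      have := vS0 0 (Ordinal lt_kn); rewrite !mxE => vS0k; rewrite -[RHS]vS0k.
      by apply: eq_bigr => j _; rewrite !mxE coefZ coef_map.
    apply: big1 => j _; rewrite coefZ coef_map /= nth_default ?rmorph0 ?mulr0 //.
    exact: leq_trans le_nk.
  rewrite -[RHS]addr0 -[X in _ + X]phi_r mulr_suml -big_split; apply: eq_bigr => j _ /=.
  by rewrite -scalerAl -scalerDr -rmorphM -rmorphD -qrE /= map_polyXn.
by rewrite phiW dvdp_mull.
Qed.

(** * The uncertainty inequality *)

Definition dft (K : numFieldType) (p : nat) (w : K) (f : {ffun 'Z_p -> K}) :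
    {ffun 'Z_p -> K} :=
  [ffun y : 'Z_p => \sum_(x : 'Z_p) f x * w ^+ (x * y)].

Lemma dft_comb (K : numFieldType) (p : nat) (w : K) (I : Type) (s : seq I)
    (P : pred I) (c : I -> K) (g : I -> {ffun 'Z_p -> K}) (y : 'Z_p) :
  dft w [ffun x => \sum_(i <- s | P i) c i * g i x] y =
  \sum_(i <- s | P i) c i * dft w (g i) y.
Proof.
under [RHS]eq_bigr => i _ do rewrite ffunE mulr_sumr.
rewrite exchange_big ffunE; apply: eq_bigr => x _.
by rewrite ffunE mulr_suml; apply: eq_bigr => i _; rewrite mulrA.
Qed.

Lemma card_Zp_prime (p : nat) : prime p -> #|'Z_p| = p.
Proof. by move=> p_pr; rewrite card_ord Zp_cast ?prime_gt1. Qed.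

Lemma subset_card_mem (T : finType) (A : {set T}) (a : T) (k : nat) :
  a \in A -> (0 < k <= #|A|)%N ->
  exists2 B : {set T}, B \subset A & (a \in B) && (#|B| == k).
Proof.
move=> aA /andP[k_gt0 le_kA].
have /card_geqP[s [s_uniq size_s sA]] : (k.-1 <= #|A :\ a|)%N.
  by rewrite (cardsD1 a A) aA in le_kA; rewrite -ltnS prednK.
exists (a |: [set x in s]).
  by apply/subsetP => x /[!inE] /predU1P[->//|/sA]; rewrite !inE => /andP[].
rewrite setU11 cardsU1 cardsE (card_uniqP s_uniq) size_s inE.
have /negPf-> : a \notin s by apply/negP => /sA; rewrite !inE eqxx.
by rewrite add1n prednK /=.
Qed.

(** Otherwise the transform vanishes at |A| or more points. The values of [f] on [A] then form a
    kernel vector of the square Fourier minor with rows in [A] and columns at |A| of these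
    points. *)
Lemma uncertainty (K : numFieldType) (p : nat) (w : K) (f : {ffun 'Z_p -> K}) :
  prime p -> p.-primitive_root w -> f != 0 ->
  (p < #|[set x | f x != 0%R]| + #|[set y | dft w f y != 0%R]|)%N.
Proof.
move=> p_pr w_prim; apply: contraNT; rewrite -leqNgt.
set A := [set x | _]; set B := [set y | _] => card_le.
have lt_p (x : 'Z_p) : (x < p)%N.
  by rewrite -[X in (_ < X)%N](Zp_cast (prime_gt1 p_pr)) ltn_ord.
have le_AC : (#|A| <= #|~: B|)%N.
  by rewrite -(leq_add2l #|B|) cardsC card_Zp_prime // addnC.
pose x (i : 'I_#|A|) : 'Z_p := enum_val i.
pose y (i : 'I_#|A|) : 'Z_p := enum_val (widen_ord le_AC i).
have x_inj : injective (x : _ -> nat) by move=> i j /val_inj/enum_val_inj.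
have y_inj : injective (y : _ -> nat).
  by move=> i j /val_inj/enum_val_inj/(congr1 val) /= /val_inj.
have := chebotarev_minor p_pr w_prim x_inj (fun i => lt_p _)
  y_inj (fun j => lt_p _).
apply: contraNT => f_neq0; apply/det0P; exists (\row_i f (x i)).
  apply: contraNneq f_neq0 => /rowP f0; apply/eqP/ffunP => a; rewrite ffunE.
  apply/eqP; apply: contraTT isT => fa_neq0.
  have aA : a \in A by rewrite inE.
  have := f0 (enum_rank_in aA a); rewrite !mxE /x enum_rankK_in // => fa0.
  by rewrite fa0 eqxx in fa_neq0.
apply/rowP => j; rewrite !mxE.
have : y j \in ~: B by apply: enum_valP.
rewrite !inE negbK ffunE => /eqP dft0; rewrite -[RHS]dft0 (bigID (mem A)) /=.
rewrite [X in _ = _ + X]big1 ?addr0; last first.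
  by move=> a; rewrite inE negbK => /eqP ->; rewrite mul0r.
by rewrite [RHS]big_enum_val; apply: eq_bigr => i _; rewrite !mxE.
Qed.

(** * Functions with prescribed supports *)

Lemma critical_support (K : numFieldType) (p : nat) (w : K) (A B : {set 'Z_p}) :
  prime p -> p.-primitive_root w -> (#|A| + #|B| = p + 1)%N ->
  exists f : {ffun 'Z_p -> K},
    [set x | f x != 0] = A /\ [set y | dft w f y != 0] = B.
Proof.
move=> p_pr w_prim card_AB.
have lt_CA : (#|~: B| < #|A|)%N.
  by rewrite -(ltn_add2l #|B|) cardsC card_Zp_prime // addnC card_AB addn1.
(* Rows carry the unknown values on [A]; columns ask the transform to vanish off [B], which is only
   |A| - 1 equations. *)
pose M := \matrix_(i < #|A|, j < #|~: B|)
  w ^+ ((enum_val i : 'Z_p) * (enum_val j : 'Z_p)).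
have : kermx M != 0.
  rewrite kermx_eq0 /row_free ltn_eqF //.
  exact: leq_ltn_trans (rank_leq_col M) lt_CA.
case/rowV0Pn => v /sub_kermxP/rowP vM v_neq0.
(* Each sum has at most one term: [v] is extended by zero outside [A]. *)
pose f := [ffun x => \sum_(i : 'I_#|A| | enum_val i == x) v 0 i] : {ffun 'Z_p -> K}.
have f_val i : f (enum_val i) = v 0 i.
  rewrite ffunE (big_pred1 i) // => j; exact: (inj_eq enum_val_inj).
have f_neq0 : f != 0.
  apply: contraNneq v_neq0 => f0; apply/eqP/rowP => i.
  by rewrite -f_val f0 ffunE mxE.
have sub_fA : [set x | f x != 0] \subset A.
  apply/subsetP => x; rewrite inE; apply: contraR => xA; rewrite ffunE big_pred0 //.
  by move=> i; apply: contraNF xA => /eqP <-; apply: enum_valP.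
have sub_fB : [set y | dft w f y != 0] \subset B.
  apply/subsetP => y; rewrite inE; apply: contraR => yB; rewrite ffunE.
  have yC : y \in ~: B by rewrite inE.
  have := vM (enum_rank_in yC y); rewrite !mxE => vM0; rewrite -[X in _ == X]vM0.
  apply/eqP; rewrite (bigID (mem A)) /= [X in _ + X]big1 ?addr0; last first.
    move=> x; apply: contraNeq; rewrite mulf_eq0 negb_or => /andP[fx _].
    by apply: (subsetP sub_fA); rewrite inE.
  rewrite big_enum_val; apply: eq_bigr => i _.
  by rewrite f_val mxE enum_rankK_in.
(* The two supports have total size at least p + 1 = |A| + |B|, so neither inclusion can be
   strict. *)
have := uncertainty p_pr w_prim f_neq0; rewrite -addn1 -card_AB => card_f.
exists f; split; apply/eqP; rewrite eqEcard ?sub_fA ?sub_fB /=.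
  rewrite -(leq_add2r #|B|); apply: leq_trans card_f _.
  by rewrite leq_add2l subset_leq_card.
rewrite -(leq_add2l #|A|); apply: leq_trans card_f _.
by rewrite leq_add2r subset_leq_card.
Qed.

(* With coefficients t^0, t^1, ..., each of the sums is a non-zero polynomial in t. *)
Lemma generic_linear_combination (F : closedFieldType) (I J : finType)
    (P : pred I) (Q : pred J) (m : J -> I -> F) :
  (forall j, Q j -> exists2 i, P i & m j i != 0) ->
  exists c : I -> F, forall j, Q j -> \sum_(i | P i) c i * m j i != 0.
Proof.
move=> m_neq0.
pose q j : {poly F} := \sum_(i | P i) m j i *: 'X^(enum_rank i).
have q_neq0 j : Q j -> q j != 0.
  case/m_neq0=> i Pi; apply: contraNneq.
  move/(congr1 (fun r : {poly F} => r`_(enum_rank i))).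
  rewrite coef0 coef_sum (bigD1 i) //= coefZ coefXn eqxx mulr1 big1 ?addr0 => [->//|k].
  case/andP=> _ ki; rewrite coefZ coefXn (inj_eq val_inj) (inj_eq enum_rank_inj).
  by rewrite eq_sym (negPf ki) mulr0.
(* A non-root of the product serves all [j] at once. *)
have /closed_nonrootP[t] : \prod_(j | Q j) q j != 0 by apply/prodf_neq0.
rewrite rootE horner_prod => /prodf_neq0 qt; exists (fun i => t ^+ enum_rank i).
move=> j Qj; apply: contraNneq (qt j Qj) => qjt; rewrite -[X in _ == X]qjt horner_sum.
by apply/eqP/eq_bigr => i _; rewrite hornerZ hornerXn mulrC.
Qed.

(** Each b in [B] lies in some subset of [B] of size p + 1 - |A|. The critical case gives [g b] with
    support [A] and transform supported in [B] and non-zero at b; the [g b] are then combined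
    generically. *)
Lemma support_exists (K : numClosedFieldType) (p : nat) (w : K) (A B : {set 'Z_p}) :
  prime p -> p.-primitive_root w -> A != set0 -> B != set0 ->
  (p < #|A| + #|B|)%N ->
  exists f : {ffun 'Z_p -> K},
    [set x | f x != 0] = A /\ [set y | dft w f y != 0] = B.
Proof.
move=> p_pr w_prim /set0Pn[a aA] /set0Pn[b0 b0B] card_AB.
have card_A : (#|A| <= p)%N by rewrite -[leqRHS](card_Zp_prime p_pr) max_card.
have /fin_all_exists[g gP] (b : 'Z_p) : exists g : {ffun 'Z_p -> K}, b \in B ->
    [/\ [set x | g x != 0] = A, [set y | dft w g y != 0] \subset B & dft w g b != 0].
  case: (boolP (b \in B)) => [bB|_]; last by exists 0.
  have [|B1 sB1 /andP[bB1 /eqP cardB1]] := @subset_card_mem _ B b (p + 1 - #|A|) bB.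
    by rewrite subn_gt0 addn1 ltnS card_A leq_subLR.
  have [|g [gA gB]] := @critical_support _ p w A B1 p_pr w_prim.
    by rewrite cardB1 subnKC // addn1 ltnW.
  by exists g => _; split; rewrite ?gB //; move: bB1; rewrite -gB inE.
(* The disjoint sum lets one choice of coefficients avoid zeros of the function on [A] and of its
   transform on [B]. *)
pose m (j : 'Z_p + 'Z_p) b := match j with inl x => g b x | inr y => dft w (g b) y end.
pose Q (j : 'Z_p + 'Z_p) := match j with inl x => x \in A | inr y => y \in B end.
have [[x xA|y yB]|c cP] := @generic_linear_combination K _ _ (mem B) Q m.
- exists b0 => //; have [gA _ _] := gP _ b0B; by move: xA; rewrite /Q -gA inE.
- by exists y => //; have [_ _] := gP _ yB.
exists [ffun x => \sum_(b in B) c b * g b x]; split; apply/setP => z; rewrite inE.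
- rewrite ffunE; case: (boolP (z \in A)) => [zA|zA]; first exact: (cP (inl z)).
  rewrite big1 ?eqxx // => b /gP[gA _ _]; apply/eqP; move: zA; rewrite -gA inE negbK.
  by move/eqP->; rewrite mulr0.
rewrite dft_comb; case: (boolP (z \in B)) => [zB|zB]; first exact: (cP (inr z)).
rewrite big1 ?eqxx // => b /gP[_ /subsetP gB _]; have := contra (gB z) zB.
by rewrite inE negbK => /eqP ->; rewrite mulr0.
Qed.

(** * The complex exponential and the root of unity [zeta] *)

Lemma cexpD (R : realType) (z1 z2 : R[i]) : cexp (z1 + z2) = cexp z1 * cexp z2.
Proof.
case: z1 z2 => [a1 b1] [a2 b2]; rewrite /cexp /= expRD cosD sinD.
apply/eqP; rewrite eq_complex /=; apply/andP; split; apply/eqP; ring.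
Qed.

Lemma cexpMn (R : realType) (z : R[i]) (n : nat) : cexp (z *+ n) = cexp z ^+ n.
Proof.
elim: n => [|n IHn]; last by rewrite mulrS cexpD IHn exprS.
by rewrite mulr0n /cexp /= expR0 cos0 sin0 mul1r.
Qed.

Lemma prime_primitive_root (R : nzRingType) (p : nat) (w : R) :
  prime p -> w != 1 -> w ^+ p = 1 -> p.-primitive_root w.
Proof.
move=> p_pr w_neq1 /(prim_order_exists (prime_gt0 p_pr))[m w_prim].
case/(primeP p_pr).2/orP => /eqP m_eq; rewrite m_eq in w_prim => //.
by rewrite -[w]expr1 (prim_expr_order w_prim) eqxx in w_neq1.
Qed.

Definition zeta (R : realType) (p : nat) : R[i] :=
  cexp (- (2 * (pi : R)%:C * 'i%C) / p%:R).

Lemma zeta_primitive (R : realType) (p : nat) :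
  prime p -> p.-primitive_root (zeta R p).
Proof.
move=> p_pr; pose t : R := 2 * pi / p%:R.
have p_neq0 : p%:R != 0 :> R by rewrite pnatr_eq0 -lt0n prime_gt0.
have pCE : p%:R = (p%:R : R)%:C by rewrite rmorph_nat.
have twoCE : 2 = (2 : R)%:C by rewrite rmorph_nat.
have zE : - (2 * (pi : R)%:C * 'i%C) / p%:R = 0 +i* (- t) :> R[i].
  rewrite pCE twoCE -fmorphV; apply/eqP; rewrite eq_complex /=.
  by apply/andP; split; apply/eqP; rewrite /t; ring.
rewrite /zeta zE; apply: prime_primitive_root => //; last first.
  have -> : (cexp (0 +i* (- t)) : R[i]) ^+ p = cexp (0 +i* (- (pi *+ 2))).
    rewrite -cexpMn -mulr_natr pCE; congr cexp; apply/eqP; rewrite eq_complex /=.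
    by apply/andP; split; apply/eqP; rewrite /t; field.
  by rewrite /cexp /= cosN sinN cos2pi sin2pi oppr0 expR0 mul1r.
(* The real part already differs from 1: since 2 <= p, [t] lies in (0, pi], and cos is injective on
   [0, pi]. *)
rewrite /cexp /= expR0 mul1r eq_complex /= negb_and cosN; apply/orP; left.
have t_gt0 : 0 < t by rewrite divr_gt0 ?mulr_gt0 ?pi_gt0 ?ltr0n ?prime_gt0.
have t_le_pi : t <= pi.
  by rewrite ler_pdivrMr ?ltr0n ?prime_gt0 // mulrC ler_pM2l ?pi_gt0 // ler_nat prime_gt1.
rewrite -cos0; apply: contraTneq (t_gt0) => /cos_inj ->; rewrite ?ltxx //.
  by rewrite in_itv /= t_le_pi ltW.
by rewrite in_itv /= lexx pi_ge0.
Qed.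

(** The factor 1/p is non-zero, and the exponentials are the powers of [zeta]. *)
Lemma supp_fourier (R : realType) (p : nat) (f : {ffun 'Z_p -> R[i]}) :
  prime p -> supp (fourier p f) = [set y | dft (zeta R p) f y != 0].
Proof.
move=> p_pr; apply/setP => y; rewrite !inE !ffunE mulf_eq0 negb_or.
rewrite invr_eq0 pnatr_eq0 -lt0n prime_gt0 //=; congr (_ != 0).
apply: eq_bigr => x _; congr (_ * _).
rewrite -cexpMn -[_ *+ (_ * _)]mulr_natr natrM; congr cexp; ring.
Qed.

Theorem theorem1p1 (R : realType) (p : nat) (hp : prime p) :
  (forall f : {ffun 'Z_p -> R[i]},
     f != 0 -> (p + 1 <= #|supp f| + #|supp (fourier p f)|)%N)
  /\
  (forall A B : {set 'Z_p},
     A != set0 -> B != set0 -> (p + 1 <= #|A| + #|B|)%N ->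
     exists f : {ffun 'Z_p -> R[i]}, supp f = A /\ supp (fourier p f) = B).
Proof.
have zeta_prim := zeta_primitive R hp; split=> [f f_neq0|A B A_neq0 B_neq0].
  by rewrite supp_fourier // addn1; apply: uncertainty.
rewrite addn1 => /(support_exists hp zeta_prim A_neq0 B_neq0)[f fP].
by exists f; rewrite supp_fourier.
Qed.
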